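(* Let $\{S_n\}_{n\ge 0}$ be a sequence of positive reals satisfying $S_n = a(n)S_{n-1} + b(n)S_{n-2}$ for all $n\ge 2$, with real $a(n),b(n)$. Suppose $N$ is a nonnegative integer such that $a(n)>0$ and $b(n)<0$ for all $n\ge N$. If there exists a function $g(n)$ such that for all $n\ge N+2$: (i') $\dfrac{a(n)}{2} \le g(n) \le \dfrac{S_n}{S_{n-1}}$; (ii') $4g^3(n) - 3a(n)g^2(n) - a(n+1)b(n) \ge 0$; (iii') $g^4(n) - a(n)g^3(n) - a(n+1)b(n)g(n) - b(n)b(n+1) \ge 0$, then $\{S_n\}_{n\ge N}$ is ratio log-convex, that is, for all $n\ge N+2$, $$\left(\frac{S_n}{S_{n-1}}\right)^2 \le \frac{S_{n-1}}{S_{n-2}}\cdot\frac{S_{n+1}}{S_n}.$$ *)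

(* Defs.v *)
From Stdlib Require Import Reals.
Open Scope R_scope.

(* The tail (s n)_{n >= N} is ratio log-convex; the smallest index occurring
   below is N, so the truncated subtractions on nat are exact. *)
Definition ratio_log_convex_from (N : nat) (s : nat -> R) : Prop :=
  forall n : nat, (N + 2 <= n)%nat ->
    (s n / s (n - 1)%nat) ^ 2 <=
    (s (n - 1)%nat / s (n - 2)%nat) * (s (n + 1)%nat / s n).

(* Main.v *)
(** Write [r = S_n / S_(n-1)], [q = S_(n-1) / S_(n-2)], [u = S_(n+1) / S_n].
    The recurrence gives [q (a(n) - r) = - b(n)] and
    [u r = a(n+1) r + b(n+1)], so the quartic
    [f x = x^4 - a(n) x^3 - a(n+1) b(n) x - b(n) b(n+1)] satisfies
    [f r = (a(n) - r) r (q u - r^2)] with [a(n) - r > 0]; the claim is thus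
    [f r >= 0].  Conditions (ii') and (iii') say that [f' >= 0] and [f >= 0]
    at [g(n) <= r], and [f'' x = 6 x (2 x - a(n)) >= 0] for [x >= a(n) / 2]. *)

Require Import Defs.
From Stdlib Require Import Reals Lra Lia.
Open Scope R_scope.

(** Convexity beyond [a / 2] keeps the quartic above its tangent at [g], whose value and slope are
    nonnegative. *)
Lemma quartic_nonneg_right (a c d g r : R) :
  0 < a -> a / 2 <= g -> g <= r ->
  0 <= 4 * g ^ 3 - 3 * a * g ^ 2 - c ->
  0 <= g ^ 4 - a * g ^ 3 - c * g - d ->
  0 <= r ^ 4 - a * r ^ 3 - c * r - d.
Proof.
  intros Ha Hg Hr Hf' Hf.
  pose (h := r - g).
  assert (Hh : 0 <= h) by (unfold h; lra).
  (* Taylor expansion at [g]: every coefficient is nonnegative. *)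
  replace (r ^ 4 - a * r ^ 3 - c * r - d) with
    ((g ^ 4 - a * g ^ 3 - c * g - d) + (4 * g ^ 3 - 3 * a * g ^ 2 - c) * h
     + 3 * (g * (2 * g - a)) * h ^ 2 + (4 * g - a) * h ^ 3 + h ^ 4)
    by (unfold h; ring).
  assert (0 <= g * (2 * g - a)) by (apply Rmult_le_pos; lra).
  pose proof (Rmult_le_pos _ _ Hf' Hh).
  pose proof (Rmult_le_pos (3 * (g * (2 * g - a))) _ ltac:(lra) (pow_le _ 2 Hh)).
  pose proof (Rmult_le_pos (4 * g - a) _ ltac:(lra) (pow_le _ 3 Hh)).
  pose proof (pow_le _ 4 Hh).
  lra.
Qed.

Theorem theorem4p2 (s a b : nat -> R) (N : nat)
  (s_pos : forall n : nat, 0 < s n)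
  (s_rec : forall n : nat, (2 <= n)%nat ->
     s n = a n * s (n - 1)%nat + b n * s (n - 2)%nat)
  (ab_sign : forall n : nat, (N <= n)%nat -> 0 < a n /\ b n < 0)
  (g_exists : exists g : nat -> R, forall n : nat, (N + 2 <= n)%nat ->
     (a n / 2 <= g n <= s n / s (n - 1)%nat) /\
     4 * g n ^ 3 - 3 * a n * g n ^ 2 - a (n + 1)%nat * b n >= 0 /\
     g n ^ 4 - a n * g n ^ 3 - a (n + 1)%nat * b n * g n
       - b n * b (n + 1)%nat >= 0) :
  ratio_log_convex_from N s.
Proof.
  intros n Hn.
  destruct g_exists as [g Hg].
  destruct (Hg n Hn) as [[Hag Hgr] [Hf' Hf]].
  destruct (ab_sign n ltac:(lia)) as [Ha Hb].
  pose proof (s_rec n ltac:(lia)) as Hrec.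
  pose proof (s_rec (n + 1)%nat ltac:(lia)) as Hrec'.
  replace (n + 1 - 1)%nat with n in Hrec' by lia.
  replace (n + 1 - 2)%nat with (n - 1)%nat in Hrec' by lia.
  pose proof (s_pos (n - 2)%nat) as Hx.
  pose proof (s_pos (n - 1)%nat) as Hy.
  pose proof (s_pos n) as Hz.
  set (x := s (n - 2)%nat) in *.
  set (y := s (n - 1)%nat) in *.
  set (z := s n) in *.
  set (w := s (n + 1)%nat) in *.
  assert (Hr : 0 < z / y) by (apply Rdiv_lt_0_compat; assumption).
  assert (Hq : 0 < y / x) by (apply Rdiv_lt_0_compat; assumption).
  assert (Hqr : y / x * (a n - z / y) = - b n) by (rewrite Hrec; field; lra).
  assert (Hur : w / z * (z / y) = a (n + 1)%nat * (z / y) + b (n + 1)%nat)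
    by (rewrite Hrec'; field; lra).
  (* By [Hqr], its product with the positive [y / x] is [- b n > 0]. *)
  assert (Har : 0 < a n - z / y) by nra.
  pose proof (quartic_nonneg_right (a n) (a (n + 1)%nat * b n)
    (b n * b (n + 1)%nat) (g n) (z / y) Ha Hag Hgr
    (Rge_le _ _ Hf') (Rge_le _ _ Hf)) as Hfr.
  set (r := z / y) in *.
  set (q := y / x) in *.
  set (u := w / z) in *.
  replace (r ^ 4 - a n * r ^ 3 - a (n + 1)%nat * b n * r - b n * b (n + 1)%nat)
    with ((a n - r) * r * (q * u - r ^ 2)) in Hfr.
  (* If [q * u < r ^ 2], the product in [Hfr] would be negative. *)
  - apply Rnot_lt_le; intro Hlt.
    assert (0 < (a n - r) * r) by (apply Rmult_lt_0_compat; assumption).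
    nra.
  (* Grouped so that the left-hand sides of [Hqr] and [Hur] appear verbatim. *)
  - transitivity (q * (a n - r) * (u * r) - r ^ 3 * (a n - r)); [ring |].
    rewrite Hqr, Hur; ring.
Qed.
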